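(* The set $H_{\mathrm{even}}$ is finite if and only if the set \[ H_{\mathrm{even}}^{\mathrm{prime}}:=\{m=2p\in H_{\mathrm{even}} : p\text{ an odd prime}\} \] is finite. More precisely, if $H_{\mathrm{even}}^{\mathrm{prime}}$ has (finite) cardinality $N$, then $|H_{\mathrm{even}}|\le 4^{N}$.
   Context: 3-Higgs primes are defined recursively: $2$ is 3-Higgs; an odd prime $p$ is 3-Higgs if and only if every prime factor $q$ of $p-1$ is a 3-Higgs prime (necessarily $q<p$) and satisfies $v_q(p-1)\le 3$ (including $v_2(p-1)\le 3$), where $v_q$ is the $q$-adic valuation. $H$ is the set of integers $m\ge 1$ such that every prime factor of $2^m+1$ is 3-Higgs, and $H_{\mathrm{even}}=H\cap 2\mathbb{Z}$. *)

(* Defs.v *)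
From mathcomp Require Import all_boot.
From mathcomp Require Import classical_sets cardinality.

Set Implicit Arguments.
Unset Strict Implicit.
Unset Printing Implicit Defensive.

Local Open Scope classical_set_scope.

(* The recursion p ~> prime factors of p - 1 is well-founded, so the least
   fixed point below is the only predicate satisfying the recursive clauses
   (see higgs3_odd). *)
Inductive higgs3 : nat -> Prop :=
| Higgs3_two : higgs3 2
| Higgs3_odd p of prime p & odd p
    & (forall q, prime q -> q %| p.-1 -> higgs3 q)
    & (forall q, prime q -> q %| p.-1 -> logn q p.-1 <= 3) : higgs3 p.

Lemma higgs3_prime p : higgs3 p -> prime p.
Proof. by case. Qed.

Lemma higgs3_odd p : prime p -> odd p ->
  higgs3 p <->
  (forall q, prime q -> q %| p.-1 -> higgs3 q /\ logn q p.-1 <= 3).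
Proof.
move=> p_pr p_odd; split; last first.
  by move=> Hp; apply: Higgs3_odd => // q q_pr /(Hp q q_pr) [].
move=> Hp; case: Hp p_odd => // {p_pr}p _ _ hq hv _ q q_pr q_dvd.
by split; [exact: hq | exact: hv].
Qed.

Definition Hset : set nat :=
  [set m | 1 <= m /\ forall q, prime q -> q %| 2 ^ m + 1 -> higgs3 q].

Definition Heven : set nat := Hset `&` [set m | 2 %| m].

Definition Heven_prime : set nat :=
  [set m | Heven m /\ exists p, [/\ prime p, odd p & m = 2 * p]].

(* Main.v *)
Require Import Defs.
From mathcomp Require Import all_boot all_algebra cyclic.
From mathcomp Require Import ring zify.
From mathcomp Require Import classical_sets cardinality.

(** Every [m] in [Heven] is twice an odd number. If [4 | m], write
    [m = 2 ^ a * k] with [k] odd and [a >= 2]. For a prime [q | 2 ^ m + 1], the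
    class of [2 ^ k] modulo [q] has order exactly [2 ^ a.+1], so
    [2 ^ a.+1 | q - 1]; for [a >= 3] this exceeds the allowed 2-adic valuation.
    For [a = 2] the prime [17 = 2 ^ 4 + 1] divides [2 ^ m + 1], and
    [17 - 1 = 2 ^ 4] ([logn2_Heven]).

    If [d * n] is in [Hset] with [n] odd, then so is [d], because [2 ^ d + 1]
    divides [2 ^ (d * n) + 1]. Applied to [m = 2 * k] with [k] odd, this puts
    [2 * d] in [Hset] for every divisor [d] of [k]. In particular [2 * p] lies
    in [Heven_prime] for every odd prime factor [p] of an [m] in [Heven]: at most
    [N] odd primes occur, where [N] is the cardinality of [Heven_prime].

    Each exponent is at most [3]. If [p ^ 4 | m], then [2 * p ^ 4] lies in
    [Hset]. With [x = 2 ^ (2 * p ^ 3)], the number [x ^ p + 1 = 2 ^ (2 * p ^ 4) + 1]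
    has a prime factor [q] that does not divide [x + 1] (the case of Zsigmondy's
    theorem given by [new_prime_factor]). The class of [16] modulo [q] then has
    order exactly [p ^ 4], hence [p ^ 4 | q - 1], which is forbidden
    ([logn_odd_Heven]).

    An [m] in [Heven] is thus determined by [N] exponents in [{0, 1, 2, 3}],
    which leaves [4 ^ N] possibilities. *)

Set Implicit Arguments.
Unset Strict Implicit.

Local Open Scope classical_set_scope.
Local Open Scope card_scope.

(** The expansion of [(y - 1) ^ n + 1] to third order in [y = x + 1]. It gives at
    once the divisibility by [x + 1] and the cofactor modulo [x + 1] and modulo
    the square of a common factor of [x + 1] and [n]. *)
Lemma oddX_add1_expansion (x : int) h :
  exists c : int, (x ^+ h.*2.+1 + 1 = (x + 1) *
    ((h.*2.+1)%:Z - (x + 1) * (h.*2.+1)%:Z * h%:Z + (x + 1) ^+ 2 * c))%R.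
Proof.
elim: h => [|h [c IH]]; first by exists 0%R; rewrite /= double0 GRing.expr1; ring.
have eqX : (x ^+ h.*2.+1 = (x + 1) *
    ((h.*2.+1)%:Z - (x + 1) * (h.*2.+1)%:Z * h%:Z + (x + 1) ^+ 2 * c) - 1)%R.
  by rewrite -IH GRing.addrK.
have -> : (h.+1).*2.+1 = (h.*2.+1 + 2)%N by lia.
exists (c * x ^+ 2 + (h.*2.+1)%:Z + h%:Z * (h.*2.+1)%:Z * (2 - (x + 1)))%R.
rewrite GRing.exprD eqX.
have -> : ((h.*2.+1 + 2)%N%:Z = 2 * h%:Z + 3)%R by lia.
have -> : ((h.+1)%:Z = h%:Z + 1)%R by lia.
have -> : ((h.*2.+1)%:Z = 2 * h%:Z + 1)%R by lia.
by ring.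
Qed.

Lemma dvdn_oddX_add1 x n : odd n -> x + 1 %| x ^ n + 1.
Proof.
move=> n_odd; have n_eq : n = (n./2).*2.+1 by lia.
have [c] := oddX_add1_expansion (Posz x) n./2; rewrite -n_eq => eqn.
have : (Posz (x + 1) %| Posz (x ^ n + 1))%Z.
  by rewrite !PoszD -GRing.rmorphXn /= in eqn *; rewrite eqn dvdz_mulr.
by [].
Qed.

(** A common prime factor of [x + 1] and the cofactor [Q] divides [p], since
    [Q] is [p] modulo [x + 1]; and [p ^ 2] does not divide [Q] when [p | x + 1].
    So if no prime factor of [Q] were new, [Q] would be [1] or [p], whereas it is
    larger than [p] for [x >= 4]. *)
Lemma new_prime_factor x p : 4 <= x -> prime p -> odd p ->
  exists q, [/\ prime q, q %| x ^ p + 1 & ~~ (q %| x + 1)].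
Proof.
move=> x_ge4 p_pr p_odd.
have p_eq : p = (p./2).*2.+1 by lia.
have p_gt2 : 2 < p by have := prime_gt1 p_pr; lia.
have /dvdnP [Q eqQ] := dvdn_oddX_add1 x p_odd.
have [c eqc] : exists c : int,
    (Q%:Z = p%:Z - (x%:Z + 1) * p%:Z * (p./2)%:Z + (x%:Z + 1) ^+ 2 * c)%R.
  have [c] := oddX_add1_expansion (Posz x) p./2; rewrite -p_eq => eqn.
  exists c; apply: (@GRing.mulfI _ (x%:Z + 1)%R); first by lia.
  rewrite -eqn GRing.mulrC -[1%R]/(Posz 1%N) -PoszD -PoszM -eqQ PoszD.
  by rewrite -GRing.rmorphXn /=; congr (_ + _)%R; elim: (p).
have Q_gtp : p < Q.
  have pow_ge n : 0 < n -> 2 * n.+1 <= x ^ n.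
    case: n => // n _; elim: n => [|n IH]; first by rewrite expn1; lia.
    by rewrite expnS; nia.
  have x1_gt0 : 0 < x + 1 by rewrite addn1.
  rewrite -(ltn_pmul2r x1_gt0) -eqQ -[in x ^ p](prednK (prime_gt0 p_pr)) expnS.
  have : x * (2 * p) <= x * x ^ p.-1.
    have p1_gt0 : 0 < p.-1 by lia.
    by have := pow_ge _ p1_gt0; rewrite prednK ?prime_gt0 // leq_mul2l orbC => ->.
  have : p * 1 <= p * x by rewrite leq_mul2l; lia.
  by lia.
have [/hasP [q]|/hasPn old] :=
    boolP (has (fun q => ~~ (q %| x + 1)) (primes (x ^ p + 1))).
  rewrite mem_primes => /and3P [q_pr _ q_dvd] q_new.
  by exists q.
have old_dvd q : prime q -> q %| Q -> q %| x + 1.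
  move=> q_pr qQ; apply: negbNE; apply: old.
  by rewrite mem_primes q_pr addn1 /= -addn1 eqQ dvdn_mulr.
have /p_natP [e eqQe] : p.-nat Q.
  apply/pnatP => [|q q_pr qQ]; first by lia.
  have q_x1 : (Posz q %| (Posz x + 1)%R)%Z by exact: (old_dvd q q_pr qQ).
  have : (Posz q %| Posz p)%Z.
    have -> : (p%:Z = Q%:Z + (x%:Z + 1) * (p%:Z * (p./2)%:Z - (x%:Z + 1) * c))%R.
      by rewrite eqc; ring.
    by rewrite GRing.rpredD ?dvdz_mulr.
  by rewrite dvdzE /= dvdn_prime2.
(* [Q = 1] and [Q = p] are too small; the case [p ^ 2 | Q] is left. *)
case: e eqQe => [|[|e]] eqQe; [by move: Q_gtp; rewrite eqQe; lia
  | by move: Q_gtp; rewrite eqQe expn1 ltnn |].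
have pQ : p ^ 2 %| Q by rewrite eqQe dvdn_exp2l.
have /dvdnP [t eqt] : p %| x + 1.
  by apply: old_dvd => //; apply: dvdn_trans pQ; rewrite dvdn_exp.
have : (Posz (p ^ 2) %| Posz p)%Z.
  have -> : (p%:Z = Q%:Z + (p ^ 2)%N%:Z * (t%:Z * (p./2)%:Z - t%:Z ^+ 2 * c))%R.
    rewrite eqc -[1%R]/(Posz 1%N) -PoszD eqt -mulnn !PoszM.
    by ring.
  by rewrite GRing.rpredD ?dvdz_mulr.
rewrite dvdzE /= => /dvdn_leq; rewrite prime_gt0 // => /(_ isT).
by rewrite -[leqRHS]expn1 leq_exp2l ?(prime_gt1 p_pr).
Qed.

(** The hypotheses say that the order of [y] modulo [q] is [r ^ e.+1], and by
    Fermat's little theorem this order divides [q - 1]. *)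
Lemma prime_power_order_dvd q r y e : prime q -> prime r ->
  y ^ (r ^ e.+1) = 1 %[mod q] -> y ^ (r ^ e) != 1 %[mod q] ->
  r ^ e.+1 %| q.-1.
Proof.
move=> q_pr r_pr y_one y_neq.
have q_gt1 := prime_gt1 q_pr.
have one_exp u n : u = 1 %[mod q] -> u ^ n = 1 %[mod q].
  by move=> u1; rewrite -modnXm u1 modnXm exp1n.
have y_cop : coprime y q.
  have : coprime (y ^ (r ^ e.+1)) q.
    by rewrite -coprime_modl y_one coprime_modl coprime1n.
  by rewrite coprime_pexpl // expn_gt0 prime_gt0.
have fermat : y ^ q.-1 = 1 %[mod q].
  by have := Euler_exp_totient y_cop; rewrite totient_prime.
(* By Bezout, [y] to the power [gcdn q.-1 (r ^ e.+1)] is [1]; a proper divisor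
   of [r ^ e.+1] would divide [r ^ e]. *)
have /(dvdn_pfactor _ _ r_pr) [f f_le eqf] := dvdn_gcdr q.-1 (r ^ e.+1).
move: f_le; rewrite leq_eqVlt => /predU1P [f_eq | f_lt].
  by rewrite -f_eq -eqf dvdn_gcdl.
case/negP: y_neq; apply/eqP.
have -> : r ^ e = r ^ f * r ^ (e - f) by rewrite -expnD subnKC.
rewrite expnM; apply: (one_exp); rewrite -eqf.
have q1_gt0 : 0 < q.-1 by lia.
case: (egcdnP (r ^ e.+1) q1_gt0) => km kn eq_bezout _.
have : y ^ (km * q.-1) = 1 %[mod q] by rewrite mulnC expnM; exact: one_exp.
rewrite eq_bezout expnD -modnMml [kn * _]mulnC expnM.
by rewrite (one_exp _ kn y_one) modnMml mul1n.
Qed.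

Lemma odd_dvd_two_pow_add1 q m : 0 < m -> q %| 2 ^ m + 1 -> odd q.
Proof.
move=> m_gt0 /dvdn_odd; apply.
by rewrite oddD oddX /= orbF; case: m m_gt0.
Qed.

Lemma sqr_eq1_modn u q : q %| u + 1 -> u ^ 2 = 1 %[mod q].
Proof.
case: u => [|u] qu.
  by move: qu; rewrite add0n dvdn1 => /eqP ->; rewrite !modn1.
apply/eqP; rewrite eqn_mod_dvd ?expn_gt0 //.
by rewrite -[X in _ - X](exp1n 2) subn_sqr dvdn_mull.
Qed.

(** The definition bounds only the valuations of [q - 1] at its prime factors and
    treats [q = 2] apart; this form is uniform in [q] and [r]. *)
Lemma higgs3_logn q r : higgs3 q -> prime r -> logn r q.-1 <= 3.
Proof.
case=> [|{}q _ _ _ le3] r_pr; first by rewrite logn1.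
have [/(le3 _ r_pr) //|nr] := boolP (r %| q.-1).
by rewrite lognE (negbTE nr) !andbF.
Qed.

Lemma higgs3_pow4 q r : higgs3 q -> prime r -> ~~ (r ^ 4 %| q.-1).
Proof.
move=> hq r_pr; rewrite pfactor_dvdn // -?ltnNge ?ltnS ?higgs3_logn //.
by have := prime_gt1 (higgs3_prime hq); lia.
Qed.

Lemma Hset_odd_dvd d n : odd n -> Hset (d * n) -> Hset d.
Proof.
move=> n_odd [dn_gt0 hdn]; split=> [|q q_pr qd].
  by move: dn_gt0; rewrite muln_gt0 => /andP [].
by apply: hdn => //; rewrite expnM (dvdn_trans qd) ?dvdn_oddX_add1.
Qed.

(** With [m = 2 ^ a * k] and [k] odd, evenness excludes [a = 0], the prime [17]
    excludes [a = 2], and for [a >= 3] every prime factor of [2 ^ m + 1] is [1]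
    modulo [2 ^ a.+1], a multiple of [16]. *)
Lemma logn2_Heven m : Heven m -> logn 2 m = 1.
Proof.
case=> -[m_gt0 hm] /= m_even.
have [a [k [k_odd eqm]]] : exists a k, odd k /\ m = 2 ^ a * k.
  have [k k2 eqm] := pfactor_coprime (isT : prime 2) m_gt0.
  by exists (logn 2 m), k; rewrite mulnC -coprime2n.
have -> : logn 2 m = a.
  rewrite eqm lognM ?expn_gt0 ?(odd_gt0 k_odd) // pfactorK //.
  by rewrite logn_coprime ?coprime2n ?addn0.
case: a eqm => [|[|[|a]]] // eqm.
- by move: m_even; rewrite eqm mul1n dvdn2 k_odd.
- have h17 : higgs3 17.
    by apply: hm => //; rewrite eqm expnM (dvdn_oddX_add1 (2 ^ (2 ^ 2)) k_odd).
  by have := higgs3_pow4 h17 (isT : prime 2).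
have [q q_pr q_dvd] : exists2 q, prime q & q %| 2 ^ m + 1.
  exists (pdiv (2 ^ m + 1)); last exact: pdiv_dvd.
  by apply: pdiv_prime; have := expn_gt0 2 m; lia.
have q_odd := odd_dvd_two_pow_add1 m_gt0 q_dvd.
have := higgs3_pow4 (hm q q_pr q_dvd) (isT : prime 2).
case/negP; apply: (@dvdn_trans (2 ^ a.+4)); first exact: dvdn_exp2l.
have eq_pow : (2 ^ k) ^ (2 ^ a.+3) = 2 ^ m by rewrite eqm -expnM mulnC.
apply: (@prime_power_order_dvd q 2 (2 ^ k)) => //.
  by rewrite [2 ^ a.+4]expnSr expnM eq_pow; exact: sqr_eq1_modn.
rewrite eq_pow; apply/negP => /eqP pow_one.
(* [2 ^ m] would be both [1] and [-1] modulo the odd prime [q]. *)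
have : q %| 2 by rewrite /dvdn -[2]/(1 + 1) -modnDml -pow_one modnDml.
by move/dvdn_leq => /(_ isT); have := prime_gt1 q_pr; lia.
Qed.

Lemma Heven_Hset_double m d : Heven m -> odd d -> d %| m -> Hset (2 * d).
Proof.
move=> hm d_odd /dvdnP [k eqm].
have [[m_gt0 _] /= m_even] := hm; have m2 := logn2_Heven hm.
have k_gt0 : 0 < k by move: m_gt0; rewrite eqm muln_gt0 => /andP [].
have k2 : logn 2 k = 1.
  by move: m2; rewrite eqm lognM ?(odd_gt0 d_odd) // (logn_coprime (m := d)) ?addn0 ?coprime2n.
have [j j2 eqk] := pfactor_coprime (isT : prime 2) k_gt0.
apply: (@Hset_odd_dvd _ j); first by rewrite -coprime2n.
by move: hm => [+ _]; rewrite eqm eqk k2 expn1; congr Hset; lia.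
Qed.

(** If [p ^ 4 | m], a prime factor of [2 ^ (2 * p ^ 4) + 1] that does not divide
    [2 ^ (2 * p ^ 3) + 1] is [1] modulo [p ^ 4], so it is not 3-Higgs. *)
Lemma logn_odd_Heven m p : Heven m -> prime p -> odd p -> logn p m <= 3.
Proof.
move=> hm p_pr p_odd; rewrite leqNgt; apply/negP => p4.
have [[m_gt0 _] _] := hm.
have [_ hd] : Hset (2 * p ^ 4).
  apply: (Heven_Hset_double hm); first by rewrite oddX p_odd orbT.
  by rewrite pfactor_dvdn.
set x := 2 ^ (2 * p ^ 3).
have eqxp : x ^ p = 2 ^ (2 * p ^ 4) by rewrite -expnM -mulnA -expnSr.
have p3_gt0 : 0 < p ^ 3 by rewrite expn_gt0 prime_gt0.
have x_ge4 : 4 <= x by rewrite -[4]/(2 ^ 2) leq_exp2l //; lia.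
have [q [q_pr q_dvd q_new]] := new_prime_factor x_ge4 p_pr p_odd.
have hq : higgs3 q by apply: hd => //; rewrite -eqxp.
apply/negP: (higgs3_pow4 hq p_pr); rewrite negbK.
have eq16 n : 16 ^ n = (2 ^ (2 * n)) ^ 2.
  by rewrite -[16]/(2 ^ 4) -!expnM; congr (_ ^ _); lia.
apply: (@prime_power_order_dvd q p 16) => //.
  by rewrite eq16 -eqxp; exact: sqr_eq1_modn.
rewrite eq16 -/x; apply: contra q_new => /eqP x2_one.
(* As [p] is odd, [x ^ 2 = 1] would give [x = x ^ p = -1] modulo [q]. *)
have x_xp : x ^ p = x %[mod q].
  have {1}-> : p = 1 + 2 * p./2 by lia.
  by rewrite expnD expnM expn1 -modnMmr -modnXm x2_one modnXm exp1n modnMmr muln1.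
by rewrite /dvdn -modnDml -x_xp modnDml.
Qed.

Lemma odd_prime_dvd_Heven m p : Heven m -> prime p -> odd p -> p %| m ->
  Heven_prime (2 * p).
Proof.
move=> hm p_pr p_odd pm; split; last by exists p.
by split; [exact: (Heven_Hset_double hm) | rewrite /= dvdn_mulr].
Qed.

(** The exponents of the [N] possible odd primes, each below [4], determine an
    element of [Heven]: [f] enumerates the numbers [2 * p]. *)
Lemma card_Heven N : Heven_prime #= `I_N -> Heven #<= `I_(4 ^ N).
Proof.
rewrite card_eq_sym => /card_set_bijP [f [_ _ f_surj]].
pose expo m := [ffun i : 'I_N => inord (logn (f i)./2 m) : 'I_4].
pose code m : nat := enum_rank (expo m).
have code_inj : {in Heven &, injective code}.
  move=> m n; rewrite !inE => hm hn /val_inj /enum_rank_inj eq_expo.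
  have [[m_gt0 _] _] := hm; have [[n_gt0 _] _] := hn.
  apply: eqn_from_log => // p.
  have [p_pr|np] := boolP (prime p); last by rewrite lognE (negbTE np) /= lognE (negbTE np).
  have [-> | p_odd] := even_prime p_pr; first by rewrite !logn2_Heven.
  have [nd | ] := boolP (~~ (p %| m) && ~~ (p %| n)).
    have [/negbTE pm /negbTE pn] := andP nd.
    by rewrite lognE pm !andbF /= lognE pn !andbF.
  rewrite negb_and !negbK => pmn.
  have : Heven_prime (2 * p).
    by case/orP: pmn; [exact: odd_prime_dvd_Heven hm _ _
                      | exact: odd_prime_dvd_Heven hn _ _].
  move=> /f_surj [i /= i_lt fi].
  have := congr1 (fun g : {ffun 'I_N -> 'I_4} => val (g (Ordinal i_lt))) eq_expo.
  by rewrite !ffunE /= fi mul2n doubleK !inordK // ltnS logn_odd_Heven.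
rewrite -(card_le_eql (inj_card_eq code_inj)).
apply: subset_card_le => _ [m _ <-] /=.
have <- : #|{ffun 'I_N -> 'I_4}| = 4 ^ N by rewrite card_ffun !card_ord.
exact: ltn_ord.
Qed.

Theorem theorem8 :
  (finite_set Heven <-> finite_set Heven_prime) /\
  (forall N : nat, Heven_prime #= `I_N -> Heven #<= `I_(4 ^ N)).
Proof.
split; last exact: card_Heven.
split=> [|/finite_setP [N /card_Heven le4]].
  by apply: sub_finite_set => m [].
by apply: card_le_finite le4 _.
Qed.
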